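(* Let $K$ be a field, $n$ a positive integer, $G$ a group with identity element $e$, and let $\rho=\overline{n}\times\overline{n}$ where $\overline{n}=\{1,\ldots,n\}$. The bijection $\Phi:\mathcal{G}(\rho,G,K)\to\mathcal{A}(\rho,G)$ induces a bijection between the set of graded $K$-algebra isomorphism classes of strictly elementary $G$-gradings on $M_n(K)$ and the set of equivalence classes of free and transitive partial actions of $G$ on $\overline{n}$.
   Context: Gradings. For $X,Y\subseteq\overline{n}\times\overline{n}$ put $XY=\{(i,k)\mid \exists j\in\overline{n}:\ (i,j)\in X,\ (j,k)\in Y\}$. A $G$-grading on $\rho$ is a family $(\rho_g)_{g\in G}$ of pairwise disjoint (possibly empty) subsets of $\rho$ with $\rho=\bigcup_{g\in G}\rho_g$ and $\rho_g\rho_h\subseteq\rho_{gh}$ for all $g,h\in G$. Let $e_{i,j}$ be the matrix with $1$ in position $(i,j)$ and zeros elsewhere. A $G$-grading $(S_g)_{g\in G}$ on $M_n(K)$ is very good if there is a $G$-grading $(\rho_g)_{g\in G}$ on $\rho$ with $S_g=\sum_{(i,j)\in\rho_g}Ke_{i,j}$ for all $g\in G$. $\mathcal{G}(\rho,G,K)$ is the set of all very good $G$-gradings $(S_g)_{g\in G}$ on $M_n(K)$ with $S_e=\bigoplus_{i=1}^nKe_{i,i}$. A very good $G$-grading on $M_n(K)$ is strictly elementary if there are pairwise distinct $g_1,\ldots,g_n\in G$ with $e_{i,j}\in S_{g_ig_j^{-1}}$ for all $i,j\in\overline{n}$; strictly elementary gradings belong to $\mathcal{G}(\rho,G,K)$.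 Two gradings $(S_g)_{g\in G}$ and $(S'_g)_{g\in G}$ on $M_n(K)$ are graded isomorphic as $K$-algebras if there is a $K$-algebra automorphism $\phi$ of $M_n(K)$ with $\phi(S_g)=S'_g$ for every $g\in G$. Partial actions. A partial action of $G$ on a set $X$ is a family $\alpha=(X_g,\alpha_g)_{g\in G}$, where $X_g\subseteq X$ and $\alpha_g:X_{g^{-1}}\to X_g$ is a bijection for every $g\in G$, such that (P1) $X_e=X$ and $\alpha_e=\mathrm{id}_X$; (P2) if $g,h\in G$, $x\in X_{h^{-1}}$ and $\alpha_h(x)\in X_{g^{-1}}$, then $x\in X_{(gh)^{-1}}$ and $\alpha_{gh}(x)=\alpha_g(\alpha_h(x))$. It is free if, whenever $x\in X_{g^{-1}}\cap X_{h^{-1}}$ and $\alpha_g(x)=\alpha_h(x)$, one has $g=h$. Its orbit equivalence relation is: $i\sim_\alpha j$ if and only if $\alpha_g(j)=i$ for some $g\in G$ with $j\in X_{g^{-1}}$. It is transitive if $i\sim_\alpha j$ for all $i,j\in X$. $\mathcal{A}(\rho,G)$ is the set of all free partial actions of $G$ on $\overline{n}$ whose orbit equivalence relation is $\rho$ (for $\rho=\overline{n}\times\overline{n}$, the free and transitive ones). Two partial actions $(X_g,\alpha_g)_{g\in G}$ on $X$ and $(Y_g,\beta_g)_{g\in G}$ on $Y$ are equivalent if there is a bijection $\sigma:X\to Y$ with $\sigma(X_g)=Y_g$ and $\sigma(\alpha_g(x))=\beta_g(\sigma(x))$ for all $g\in G$ and $x\in X_{g^{-1}}$. The bijection $\Phi$.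 For $\mathcal{S}=(S_g)_{g\in G}\in\mathcal{G}(\rho,G,K)$ and $g\in G$ put $\rho_g^{\mathcal{S}}=\{(i,j)\in\rho\mid e_{i,j}\in S_g\}$ and $X_g^{\mathcal{S}}=\{i\in\overline{n}\mid (i,j)\in\rho_g^{\mathcal{S}}\text{ for some }j\in\overline{n}\}$, and let $\alpha_g^{\mathcal{S}}:X_{g^{-1}}^{\mathcal{S}}\to X_g^{\mathcal{S}}$ be given by $\alpha_g^{\mathcal{S}}(j)=i\Leftrightarrow(i,j)\in\rho_g^{\mathcal{S}}$; then $\Phi(\mathcal{S}):=(X_g^{\mathcal{S}},\alpha_g^{\mathcal{S}})_{g\in G}$. *)

(* Defs.v *)
From HB Require Import structures.
From mathcomp Require Import all_boot all_algebra all_field.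
From mathcomp Require Import boolp classical_sets functions.

Set Implicit Arguments.
Unset Strict Implicit.
Unset Printing Implicit Defensive.

Import GRing.Theory.
Local Open Scope classical_set_scope.
Local Open Scope ring_scope.

Definition eqv_class (T : Type) (A : set T) (R : T -> T -> Prop) (x : T) :
    set T :=
  [set y | A y /\ R x y].

Definition eqv_classes (T : Type) (A : set T) (R : T -> T -> Prop) :
    set (set T) :=
  eqv_class A R @` A.

Definition rel_comp (T : Type) (X Y : set (T * T)) : set (T * T) :=
  [set p | exists j : T, X (p.1, j) /\ Y (j, p.2)].

Definition is_rel_grading (G : groupType) (T : Type) (rho : set (T * T))
    (rho_ : G -> set (T * T)) : Prop :=
  [/\ forall g h, g != h -> rho_ g `&` rho_ h = set0,
      rho = \bigcup_g rho_ g
    & forall g h, rel_comp (rho_ g) (rho_ h) `<=` rho_ (g * h)%g].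

(* A is the internal direct sum of the S_g: as G may be infinite, this is
   expressed through the finite subfamilies. *)
Definition is_alg_grading (G : groupType) (K : fieldType) (A : falgType K)
    (S : G -> {vspace A}) : Prop :=
  [/\ forall a : A, exists s : seq G, a \in (\sum_(g <- s) S g)%VS,
      forall (s : seq G) (a : G -> A), uniq s ->
        (forall g, g \in s -> a g \in S g) ->
        \sum_(g <- s) a g = 0 -> forall g, g \in s -> a g = 0
    & forall g h, (S g * S h <= S (g * h)%g)%VS].

(* The algebra of matrices of size n >= 1 is written 'M_n.+1, the size for
   which the library provides the algebra structure. *)
Definition mx_family (G : groupType) (K : fieldType) (n : nat) : Type :=
  G -> {vspace 'M[K]_n.+1}.

Definition very_good (G : groupType) (K : fieldType) (n : nat) :
    set (mx_family G K n) :=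
  [set S | is_alg_grading S /\
    exists2 rho_ : G -> set ('I_n.+1 * 'I_n.+1), is_rel_grading setT rho_ &
      forall g, S g = (\sum_(p | p \in rho_ g) <[delta_mx p.1 p.2]>)%VS].

(* The very good gradings attached to the full relation on n.+1 indices whose
   identity component consists of the diagonal matrices. *)
Definition very_good_diag (G : groupType) (K : fieldType) (n : nat) :
    set (mx_family G K n) :=
  [set S | very_good S /\ S 1%g = (\sum_i <[delta_mx i i]>)%VS].

Definition strictly_elementary (G : groupType) (K : fieldType) (n : nat) :
    set (mx_family G K n) :=
  [set S | very_good S /\
    exists2 g_ : 'I_n.+1 -> G, injective g_ &
      forall i j, delta_mx i j \in S (g_ i * (g_ j)^-1)%g].

Definition graded_iso (G : groupType) (K : fieldType) (n : nat)
    (S S' : mx_family G K n) : Prop :=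
  exists2 phi : {lrmorphism 'M[K]_n.+1 -> 'M[K]_n.+1}, bijective phi &
    forall g, phi @` [set` S g] = [set` S' g].

(* The data of a family (X_g, alpha_g): each alpha_g is a partial function,
   with value None outside of its domain X_{g^-1} (see is_paction). *)
Record paction_data (G : groupType) (T : Type) := PactionData {
  pa_set : G -> set T;
  pa_map : G -> T -> option T
}.

(* The first two clauses say that alpha_g is a bijection from X_{g^-1} to X_g,
   undefined elsewhere; the last two are the axioms (P1) and (P2). *)
Definition is_paction (G : groupType) (T : Type) (alpha : paction_data G T) :
    Prop :=
  [/\ forall g,
        set_bij (pa_set alpha g^-1%g) (Some @` pa_set alpha g) (pa_map alpha g),
      forall g x, ~ pa_set alpha g^-1%g x -> pa_map alpha g x = None,
      pa_set alpha 1%g = setT /\ (forall x, pa_map alpha 1%g x = Some x)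
    & forall g h x y, pa_map alpha h x = Some y -> pa_set alpha g^-1%g y ->
        pa_set alpha (g * h)^-1%g x /\
        pa_map alpha (g * h)%g x = pa_map alpha g y].

Definition pa_free (G : groupType) (T : Type) (alpha : paction_data G T) :
    Prop :=
  forall g h x y,
    pa_map alpha g x = Some y -> pa_map alpha h x = Some y -> g = h.

Definition pa_orbit (G : groupType) (T : Type) (alpha : paction_data G T)
    (i j : T) : Prop :=
  exists2 g, pa_set alpha g^-1%g j & pa_map alpha g j = Some i.

Definition pa_transitive (G : groupType) (T : Type) (alpha : paction_data G T) :
    Prop :=
  forall i j, pa_orbit alpha i j.

Definition free_pactions (G : groupType) (T : Type) (rho : set (T * T)) :
    set (paction_data G T) :=
  [set alpha | [/\ is_paction alpha, pa_free alpha
    & [set p | pa_orbit alpha p.1 p.2] = rho]].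

Definition free_trans_pactions (G : groupType) (T : Type) :
    set (paction_data G T) :=
  [set alpha | [/\ is_paction alpha, pa_free alpha & pa_transitive alpha]].

Definition pa_equiv (G : groupType) (T U : Type)
    (alpha : paction_data G T) (beta : paction_data G U) : Prop :=
  exists sigma : T -> U,
    [/\ bijective sigma,
        forall g, sigma @` pa_set alpha g = pa_set beta g
      & forall g x, pa_set alpha g^-1%g x ->
          omap sigma (pa_map alpha g x) = pa_map beta g (sigma x)].

Definition grading_rel (G : groupType) (K : fieldType) (n : nat)
    (S : mx_family G K n) (g : G) : set ('I_n.+1 * 'I_n.+1) :=
  [set p | delta_mx p.1 p.2 \in S g].

(* On very_good_diag the index picked below is unique, see Phi_mapP. *)
Definition Phi (G : groupType) (K : fieldType) (n : nat)
    (S : mx_family G K n) : paction_data G 'I_n.+1 :=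
  {| pa_set := fun g => [set i | exists j, grading_rel S g (i, j)];
     pa_map := fun g j => [pick i | (i, j) \in grading_rel S g] |}.

Lemma Phi_mapP (G : groupType) (K : fieldType) (n : nat)
    (S : mx_family G K n) (g : G) (i j : 'I_n.+1) :
  very_good_diag S ->
  pa_map (Phi S) g j = Some i <-> grading_rel S g (i, j).
Proof.
case=> -[[_ indep Smul] [rho_ [_ covr _] defS]] S1.
have diagS k : delta_mx k k \in S 1%g.
  by rewrite S1; apply: (subvP (sumv_sup k isT (subvv _))); exact: memv_line.
have diag a b : delta_mx a b \in S 1%g -> a = b.
  rewrite S1 => /memv_sumP[u uP] /matrixP/(_ a b).
  rewrite mxE !eqxx summxE /= => sum1.
  apply/eqP; apply: contraT => neq_ab; move: sum1; rewrite big1.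
    by move/eqP; rewrite oner_eq0.
  move=> k _; have /vlineP[c ->] := uP k isT; rewrite !mxE.
  have [ak|_] := eqVneq a k; last by rewrite mulr0.
  by rewrite -ak eq_sym (negbTE neq_ab) mulr0.
have mulE a b c : delta_mx a c = delta_mx a b * delta_mx b c :> 'M[K]_n.+1.
  by rewrite -[RHS]/(delta_mx a b *m delta_mx b c) mul_delta_mx.
have uniq_i a b : grading_rel S g (a, j) -> grading_rel S g (b, j) -> a = b.
  rewrite /grading_rel /= => Sa Sb.
  have [h Sh] : exists h, delta_mx j b \in S h.
    have : [set: 'I_n.+1 * 'I_n.+1] (j, b) by [].
    rewrite covr => -[h _ hp]; exists h; rewrite defS.
    have pin : (j, b) \in rho_ h by rewrite inE.
    by apply: (subvP (sumv_sup _ pin (subvv _))); exact: memv_line.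
  have Sgh c : delta_mx c j \in S g -> delta_mx c b \in S (g * h)%g.
    by move=> Sc; rewrite (mulE c j b) (subvP (Smul g h)) ?memv_mul.
  have gh1 : (g * h = 1)%g.
    apply/eqP; apply: contraT => gh_neq1.
    pose a_ (k : G) : 'M[K]_n.+1 := if k == 1%g then - delta_mx b b else delta_mx b b.
    have a1 : a_ 1%g = - delta_mx b b by rewrite /a_ eqxx.
    have agh : a_ (g * h)%g = delta_mx b b by rewrite /a_ (negbTE gh_neq1).
    have /matrixP/(_ b b) : a_ (g * h)%g = 0.
      apply: (indep [:: (g * h)%g; 1%g]); rewrite ?inE ?eqxx //=.
      - by rewrite inE gh_neq1.
      - move=> k; rewrite !inE => /orP[]/eqP->.
          by rewrite agh; exact: Sgh.
        by rewrite a1 rpredN.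
      - by rewrite !big_cons big_nil agh a1 addr0 subrr.
    by rewrite agh !mxE !eqxx => /eqP; rewrite oner_eq0.
  by apply: diag; rewrite -gh1 Sgh.
rewrite /Phi /=; split; case: pickP => [k|].
- by rewrite inE => Sk [<-].
- by [].
- by rewrite inE => Sk Si; rewrite (uniq_i _ _ Sk Si).
- by move=> none Si; have := none i; rewrite mem_set.
Qed.

(* Main.v *)
(* A very good grading of M_n(K) by the full relation is the same thing as a
   map c with c i j * c j k = c i k, where c i j is the degree of e_ij; its
   identity component is the algebra of diagonal matrices iff c i j = 1 only
   for i = j, and then c i j = g_i g_j^-1 with g_i := c i 0 pairwise distinct,
   so that the grading is strictly elementary.  The same maps c parametrize the
   free transitive partial actions, by alpha_g(j) = i iff c i j = g.  Through
   this dictionary both isomorphism of gradings and equivalence of partial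
   actions say that c and c' differ by a permutation s of the indices.  To
   extract s from a graded automorphism phi, observe that the phi(e_ii) are
   nonzero pairwise orthogonal diagonal matrices, hence have pairwise disjoint
   supports, which are therefore singletons {s i}; then phi(e_ij) has a nonzero
   entry at (s i, s j). *)
Require Import Defs.
From HB Require Import structures.
From mathcomp Require Import all_boot all_fingroup all_algebra all_field.
From mathcomp Require Import classical_sets functions boolp.

Set Implicit Arguments.
Unset Strict Implicit.
Unset Printing Implicit Defensive.

Import GRing.Theory.
Local Open Scope ring_scope.

(** * Degree maps: multiplicative maps from pairs of indices to the group *)

Definition cocycle (G : groupType) (I : Type) (c : I -> I -> G) : Prop :=
  forall i j k, (c i j * c j k = c i k)%g.

Definition free_cocycle (G : groupType) (I : Type) (c : I -> I -> G) : Prop :=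
  cocycle c /\ forall i j, c i j = 1%g -> i = j.

Definition mx_grading (G : groupType) (K : fieldType) (n : nat)
    (c : 'I_n.+1 -> 'I_n.+1 -> G) : mx_family G K n :=
  fun g => (\sum_(p | c p.1 p.2 == g) <[delta_mx p.1 p.2]>)%VS.

Section Cocycle.
Variables (G : groupType) (I : Type) (c : I -> I -> G).

Lemma cocycle_diag i : cocycle c -> c i i = 1%g.
Proof. by move=> cM; apply: (mulgI (c i i)); rewrite cM mulg1. Qed.

Lemma cocycle_inv i j : cocycle c -> c j i = (c i j)^-1%g.
Proof.
by move=> cM; apply: (mulgI (c i j)); rewrite cM mulgV cocycle_diag.
Qed.

(** Indeed [c i k = c i j * c j k = c k j * c j k = c k k = 1]. *)
Lemma free_cocycle_injl i k j : free_cocycle c -> c i j = c k j -> i = k.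
Proof.
by case=> cM c1 cij; apply: c1; rewrite -(cM i j k) cij cM cocycle_diag.
Qed.

End Cocycle.

(** * Gradings and partial actions expressed through degree maps *)

Section MxGrading.
Variables (G : groupType) (K : fieldType) (n : nat).
Implicit Types (c : 'I_n.+1 -> 'I_n.+1 -> G) (S : mx_family G K n).

(** Membership becomes a condition on the support of the matrix, so that later arguments can be
    carried out entry by entry. *)
Lemma mem_mx_grading c g (A : 'M[K]_n.+1) :
  A \in mx_grading K c g <-> forall i j, A i j != 0 -> c i j = g.
Proof.
split=> [/memv_sumP[u uP ->] i j|Ag].
  apply: contra_neq_eq => cij; rewrite summxE big1 // => p /eqP cp.
  have /vlineP[a ->] := uP p (introT eqP cp); rewrite !mxE.
  case: eqP => [ip|]; last by rewrite mulr0.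
  case: eqP => [jp|]; last by rewrite mulr0.
  by rewrite ip jp cp eqxx in cij.
rewrite [A]matrix_sum_delta; apply: rpred_sum => i _; apply: rpred_sum => j _.
have [->|/Ag/eqP cij] := eqVneq (A i j) 0; first by rewrite scale0r rpred0.
apply/rpredZ/(subvP (sumv_sup (i, j) cij (subvv _))); exact: memv_line.
Qed.

Lemma delta_mx_grading c g i j :
  delta_mx i j \in mx_grading K c g <-> c i j = g.
Proof.
rewrite mem_mx_grading; split=> [|cij k l].
  by apply; rewrite mxE !eqxx oner_eq0.
by rewrite mxE; case: (k =P i) => [->|]; case: (l =P j) => [->|]; rewrite ?eqxx.
Qed.

Lemma mx_grading_diag c : free_cocycle c ->
  mx_grading K c 1%g = (\sum_i <[delta_mx i i]>)%VS.
Proof.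
move=> [cM c1]; apply/eqP; rewrite eqEsubv; apply/andP; split; apply/subv_sumP.
  move=> [i j] /= /eqP/c1 ->; exact: (sumv_sup j).
move=> i _; rewrite -memvE; apply/delta_mx_grading; exact: cocycle_diag.
Qed.

Lemma mx_grading_alg c : cocycle c -> is_alg_grading (mx_grading K c).
Proof.
move=> cM; split=> [A|s a s_uniq aS a0 g gs|g h].
(* The degrees that occur form a finite list, even when [G] is infinite. *)
- pose s := undup [seq c p.1 p.2 | p <- enum {: 'I_n.+1 * 'I_n.+1}]; exists s.
  rewrite [A]matrix_sum_delta; apply: rpred_sum => i _; apply: rpred_sum => j _.
  apply: rpredZ; have cs : c i j \in s.
    by rewrite mem_undup; apply/mapP; exists (i, j); rewrite ?mem_enum.
  rewrite (bigD1_seq _ cs) ?undup_uniq //=; apply: (subvP (addvSl _ _)).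
  exact/delta_mx_grading.
(* An entry [(i, j)] can be nonzero only in the summand of degree [c i j], so nothing cancels it in
   the sum. *)
- apply/matrixP=> i j; rewrite [RHS]mxE; apply/eqP; apply: contraT => aij.
  have /mem_mx_grading/(_ _ _ aij) cij := aS g gs.
  move/matrixP/(_ i j)/eqP: a0; rewrite summxE (bigD1_seq g) //= big_seq_cond.
  rewrite big1 ?addr0 ?mxE ?(negbTE aij) // => h /andP[hs hg].
  apply: contraNeq hg => ahij; rewrite -cij.
  by have /mem_mx_grading/(_ _ _ ahij) -> := aS h hs.
- apply/prodvP => u v /mem_mx_grading ug /mem_mx_grading vh.
  apply/mem_mx_grading => i k; rewrite mxE => uv.
  have /existsP[j] : [exists j, u i j * v j k != 0].
    apply: contraNT uv; rewrite negb_exists => /forallP uv.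
    by rewrite big1 // => j _; apply/eqP; have := uv j; rewrite negbK.
  by rewrite mulf_eq0 negb_or => /andP[/ug <- /vh <-]; rewrite cM.
Qed.

Lemma mx_grading_very_good c : cocycle c -> very_good (mx_grading K c).
Proof.
move=> cM; split; first exact: mx_grading_alg.
exists (fun g => [set p | c p.1 p.2 = g]%classic).
  split.
  - move=> g h gh; apply/seteqP; split=> // p [/= -> /eqP].
    by rewrite (negbTE gh).
  - by apply/seteqP; split=> // p _; exists (c p.1 p.2).
  - by move=> g h [i k] [j [/= <- <-]]; rewrite /= cM.
by move=> g; apply: eq_bigl => p; apply/eqP/idP; rewrite inE.
Qed.

(** Covering gives every pair a degree, disjointness makes it unique, and the product inclusion
    becomes the cocycle identity. *)
Lemma very_goodP S : very_good S -> exists2 c, cocycle c & S = mx_grading K c.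
Proof.
case=> _ [rho_ [rho_disj rho_cover rhoM] defS].
have rhoE i j : exists g, rho_ g (i, j).
  have : [set: 'I_n.+1 * 'I_n.+1]%classic (i, j) by [].
  by rewrite rho_cover => -[g _ ?]; exists g.
pose c i j := projT1 (cid (rhoE i j)).
have rho_c i j : rho_ (c i j) (i, j) by rewrite /c; case: cid.
have cP g i j : rho_ g (i, j) -> c i j = g.
  move=> gij; apply/eqP; apply: contraT => /rho_disj/seteqP[/(_ (i, j)) []].
  by split.
exists c.
  by move=> i j k; apply/esym/cP/rhoM; exists j.
apply/funext => g; rewrite defS; apply: eq_bigl => -[i j].
by apply/idP/eqP => [|<-]; rewrite inE //; exact: cP.
Qed.

Lemma mx_grading_very_good_diag c :
  free_cocycle c -> very_good_diag (mx_grading K c).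
Proof.
by move=> fc; split; [apply/mx_grading_very_good/fc.1 | exact: mx_grading_diag].
Qed.

Lemma very_good_diagP S :
  very_good_diag S <-> exists2 c, free_cocycle c & S = mx_grading K c.
Proof.
split=> [[/very_goodP[c cM ->] S1]|[c fc ->]]; last first.
  exact: mx_grading_very_good_diag.
(* If [delta_mx i j] has degree 1, it is a sum of diagonal matrices; its entry 1 at [(i, j)] then
   forces [i = j]. *)
exists c => //; split=> // i j /(delta_mx_grading c 1%g i j).2.
rewrite S1 => /memv_sumP[u uP] /matrixP/(_ i j)/eqP.
rewrite mxE !eqxx summxE /= => sum1; apply/eqP; apply: contraTT sum1 => ij.
rewrite big1 ?oner_eq0 // => k _; have /vlineP[a ->] := uP k isT; rewrite !mxE.
case: eqP => [ik|]; last by rewrite mulr0.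
by rewrite -ik eq_sym (negbTE ij) mulr0.
Qed.

Lemma strictly_elementaryE : @strictly_elementary G K n = @very_good_diag G K n.
Proof.
apply/seteqP; split=> S.
  case=> /very_goodP[c cM ->] [g_ g_inj cg]; apply/very_good_diagP.
  exists c => //.
  split=> // i j; have /delta_mx_grading -> := cg i j.
  by move/divg1_eq/g_inj.
case/very_good_diagP => c fc ->; case: (fc) => cM c1.
split; first exact: mx_grading_very_good.
(* A column of [c] is injective by freeness, and [c i 0 * (c j 0)^-1 = c i 0 * c 0 j = c i j]. *)
exists (c ^~ ord0); first by move=> i k; exact: free_cocycle_injl.
by move=> i j; apply/delta_mx_grading; rewrite -cocycle_inv // cM.
Qed.

Lemma Phi_mx_grading_map c g i j : free_cocycle c ->
  pa_map (Phi (mx_grading K c)) g j = Some i <-> c i j = g.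
Proof.
move=> fc; rewrite Phi_mapP; last exact: mx_grading_very_good_diag.
exact: delta_mx_grading.
Qed.

Lemma Phi_mx_grading_set c g i :
  pa_set (Phi (mx_grading K c)) g i <-> exists j, c i j = g.
Proof. by split=> -[j cij]; exists j; apply/delta_mx_grading. Qed.

Lemma Phi_mx_grading_dom c g j : cocycle c ->
  pa_set (Phi (mx_grading K c)) g^-1%g j <-> exists i, c i j = g.
Proof.
move=> cM; rewrite Phi_mx_grading_set; split=> -[i cij]; exists i.
  by rewrite (cocycle_inv j i cM) cij invgK.
by rewrite (cocycle_inv i j cM) cij.
Qed.

Lemma Phi_mx_grading_inj c c' : free_cocycle c -> free_cocycle c' ->
  Phi (mx_grading K c) = Phi (mx_grading K c') -> c = c'.
Proof.
move=> fc fc' PhiE; apply/funext => i; apply/funext => j.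
by apply/esym/(Phi_mx_grading_map _ _ _ fc');
  rewrite -PhiE; apply/Phi_mx_grading_map.
Qed.

Lemma Phi_mx_grading_free_trans c :
  free_cocycle c -> free_trans_pactions (Phi (mx_grading K c)).
Proof.
move=> fc; have [cM c1] := fc; have mapP g i j := Phi_mx_grading_map g i j fc.
have domP g j := Phi_mx_grading_dom g j cM.
split.
- split.
  + move=> g; split.
    * move=> j /domP[i cij]; exists i; last exact/esym/mapP.
      by apply/Phi_mx_grading_set; exists j.
    * move=> j k; rewrite !inE => /domP[i cij] _ /esym.
      rewrite ((mapP g i j).2 cij) => /mapP cik.
      (* Here [c i j = c i k]; inverting both sides moves the differing indices to the first
         argument. *)
      by apply: (free_cocycle_injl (j := i) fc);
        rewrite !(cocycle_inv i _ cM) cij cik.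
    * move=> _ [i /Phi_mx_grading_set[j cij] <-]; exists j; last exact/mapP.
      by apply/domP; exists i.
  + move=> g j ndom; case E: (pa_map _ _ _) => [i|//]; case: ndom.
    by apply/domP; exists i; apply/mapP.
  + split; last by move=> i; apply/mapP; exact: cocycle_diag.
    apply/seteqP; split=> // i _; apply/Phi_mx_grading_set; exists i.
    exact: cocycle_diag.
  (* For (P2), [h] sends [j] to [k] and [g] sends [k] to [i], whence
     [c i j = c i k * c k j = g * h]. *)
  + move=> g h j k /mapP ckj /domP[i cik].
    have cij : c i j = (g * h)%g by rewrite -cik -ckj cM.
    by split; [apply/domP; exists i | rewrite !((mapP _ i _).2 _)].
- by move=> g h j i /mapP <- /mapP.
- by move=> i j; exists (c i j); [apply/domP; exists i | apply/mapP].
Qed.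

(** Transitivity provides an element [c i j] carrying [j] to [i], and freeness makes it unique. The
    cocycle identity is then (P2), and [c i j = 1] implies [i = j] by (P1). *)
Lemma free_trans_pactionsP (alpha : paction_data G 'I_n.+1) :
  free_trans_pactions alpha ->
  exists2 c, free_cocycle c & alpha = Phi (mx_grading K c).
Proof.
case=> -[bij_map map_none [_ map1] mapM] alpha_free alpha_trans.
pose c i j := projT1 (cid2 (alpha_trans i j)).
have map_c i j : pa_map alpha (c i j) j = Some i by rewrite /c; case: cid2.
have dom_c i j : pa_set alpha (c i j)^-1%g j by rewrite /c; case: cid2.
have mapP g i j : pa_map alpha g j = Some i <-> c i j = g.
  by split=> [|<-//]; apply: alpha_free.
have fc : free_cocycle c.
  split=> [i j k|i j]; last by move/mapP; rewrite map1 => -[].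
  have [_] := mapM _ _ _ _ (map_c j k) (dom_c i j).
  by rewrite map_c => /mapP.
exists c => //.
have setE : pa_set alpha = pa_set (Phi (mx_grading K c)).
  apply/funext => g; apply/seteqP; split=> i.
    have [_ _ sur] := bij_map g => gi; apply/Phi_mx_grading_set.
    have [|j _ /mapP cij] := sur (Some i); first by exists i.
    by exists j.
  case/Phi_mx_grading_set => j cij; have [fun_map _ _] := bij_map g.
  have [|k gk] := fun_map j; first by rewrite -cij.
  by rewrite ((mapP g i j).2 cij) => -[<-].
have mapE : pa_map alpha = pa_map (Phi (mx_grading K c)).
  apply/funext => g; apply/funext => j; case E: (pa_map alpha g j) => [i|].
    by apply/esym/(Phi_mx_grading_map _ _ _ fc)/mapP.
  case F: (pa_map _ g j) => [i|//].
  by move/(Phi_mx_grading_map _ _ _ fc)/mapP: F; rewrite E.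
transitivity (PactionData (pa_set alpha) (pa_map alpha)).
  by case: (alpha).
by rewrite setE mapE.
Qed.

End MxGrading.

(** * Isomorphisms and equivalences as permutations of the indices *)

Section Equivalence.
Variables (G : groupType) (K : fieldType) (n : nat).
Implicit Types (c : 'I_n.+1 -> 'I_n.+1 -> G) (s : {perm 'I_n.+1}).

Lemma pa_equivP c c' : free_cocycle c -> free_cocycle c' ->
  pa_equiv (Phi (mx_grading K c)) (Phi (mx_grading K c')) <->
  exists s, forall i j, c' (s i) (s j) = c i j.
Proof.
move=> fc fc'; have mapP g i j := Phi_mx_grading_map K g i j fc.
have map'P g i j := Phi_mx_grading_map K g i j fc'.
have domP g j := Phi_mx_grading_dom K g j fc.1.
split=> [[sigma [/bij_inj sigma_inj _ sigma_map]]|[s cs]].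
  exists (perm sigma_inj) => i j; rewrite !permE; apply/map'P.
  rewrite -sigma_map; first by rewrite ((mapP _ i j).2 _).
  by apply/domP; exists i.
exists s; split.
- exact/injF_bij/perm_inj.
- move=> g; apply/seteqP; split=> [_ [i /Phi_mx_grading_set[j cij] <-]|i].
    by apply/Phi_mx_grading_set; exists (s j); rewrite cs.
  case/Phi_mx_grading_set => j cij; exists ((s^-1)%g i); last exact: permKV.
  by apply/Phi_mx_grading_set; exists ((s^-1)%g j); rewrite -cs !permKV.
- move=> g j /domP[i cij]; rewrite ((mapP g i j).2 cij) /=; apply/esym/map'P.
  by rewrite cs.
Qed.

(** This is conjugation by a permutation matrix. It sends [delta_mx (s i) (s j)] to [delta_mx i j],
    so the isomorphism realizing [s] is [perm_conj s^-1]. *)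
Definition perm_conj s (A : 'M[K]_n.+1) : 'M[K]_n.+1 := mxsub s s A.

Lemma perm_conj_linear s : linear (perm_conj s).
Proof. by move=> a A B; apply/matrixP=> i j; rewrite !mxE. Qed.

HB.instance Definition _ s :=
  GRing.isLinear.Build K _ _ _ (perm_conj s) (perm_conj_linear s).

Lemma perm_conj_monoid_morphism s : monoid_morphism (perm_conj s).
Proof.
split=> [|A B]; apply/matrixP=> i j; rewrite !mxE ?(inj_eq perm_inj) //.
by rewrite (reindex_perm s); apply: eq_bigr => k _; rewrite !mxE.
Qed.

HB.instance Definition _ s :=
  GRing.isMonoidMorphism.Build _ _ (perm_conj s) (perm_conj_monoid_morphism s).

Lemma graded_isoP c c' : free_cocycle c -> free_cocycle c' ->
  graded_iso (mx_grading K c) (mx_grading K c') <->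
  exists s, forall i j, c' (s i) (s j) = c i j.
Proof.
move=> fc fc'; split=> [[phi phi_bij phiS]|[s cs]]; last first.
  exists (perm_conj s^-1%g).
    exists (perm_conj s) => A; apply/matrixP=> i j; rewrite !mxE.
      by rewrite !permK.
    by rewrite !permKV.
  move=> g; apply/seteqP; split=> [_ [A /= /mem_mx_grading Ag <-]|A /=].
    apply/mem_mx_grading => i j; rewrite mxE => /Ag <-.
    by rewrite -cs !permKV.
  move/mem_mx_grading => Ag; exists (perm_conj s A); last first.
    by apply/matrixP=> i j; rewrite !mxE !permKV.
  by apply/mem_mx_grading => i j; rewrite mxE => /Ag; rewrite cs.
have phi_mem A g : A \in mx_grading K c g -> phi A \in mx_grading K c' g.
  move=> Ag.
  have : (phi @` [set` mx_grading K c g])%classic (phi A) by exists A.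
  by rewrite phiS.
have mulE a b d : delta_mx a b * delta_mx b d = delta_mx a d :> 'M[K]_n.+1.
  exact: mul_delta_mx.
pose f i := phi (delta_mx i i).
have f_diag i k l : k != l -> f i k l = 0.
  have /phi_mem/mem_mx_grading fi : delta_mx i i \in mx_grading K c 1%g.
    by apply/delta_mx_grading/cocycle_diag; case: fc.
  apply: contraNeq => /fi; case: fc' => _ c'1 /c'1 ->; exact: eqxx.
(* Since [f i * f j = 0] and both factors are diagonal, their diagonal entries multiply to 0. *)
have f_disj i j k : i != j -> f i k k != 0 -> f j k k = 0.
  move=> ij fik; have : (f i * f j) k k = 0.
    have -> : f i * f j = 0; last by rewrite mxE.
    by rewrite -rmorphM -[_ * _]/(_ *m _) mul_delta_mx_0 // raddf0.
  rewrite mxE (bigD1 k) //= big1 ?addr0.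
    by move/eqP; rewrite mulf_eq0 (negbTE fik) => /eqP.
  by move=> l lk; rewrite f_diag ?mul0r // eq_sym.
have f_supp i : exists k, f i k k != 0.
  apply/existsP; apply: contraT; rewrite negb_exists => /forallP f0.
  have : delta_mx i i = 0 :> 'M[K]_n.+1.
    apply: (bij_inj phi_bij); rewrite raddf0; apply/matrixP => k l.
    rewrite [RHS]mxE; have [->|] := eqVneq k l; last exact: f_diag.
    by apply/eqP; have := f0 l; rewrite negbK.
  by move/matrixP/(_ i i)/eqP; rewrite !mxE !eqxx oner_eq0.
have [s0 s0P] := choice f_supp.
have s0_inj : injective s0.
  move=> i j s0ij; apply/eqP; apply: contraT => ij.
  have /eqP := f_disj i j (s0 i) ij (s0P i).
  by rewrite s0ij (negbTE (s0P j)).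
pose s := perm s0_inj; have sP i : f i (s i) (s i) != 0 by rewrite permE.
(* Supports are singletons: as [s] is onto, [k = s m] lies in the support of [f m], and disjointness
   gives [m = i]. *)
have f_unique i k : f i k k != 0 -> k = s i.
  rewrite -[k](permKV s); set m := (s^-1)%g k => fim; congr (s _).
  by apply/eqP; apply: contraNT fim => mi; rewrite (f_disj m) // eq_sym.
exists s => i j.
have /phi_mem/mem_mx_grading -> // : delta_mx i j \in mx_grading K c (c i j).
  exact/delta_mx_grading.
(* It remains to see that [phi (delta_mx i j)] is nonzero at [(s i, s j)]. Otherwise the product
   [phi (delta_mx j i) * phi (delta_mx i j) = f j] would vanish at [(s j, s j)]. *)
have := sP j; rewrite /f -(mulE j i j) rmorphM mxE; apply: contraNneq => phi0.
rewrite big1 // => k _.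
have [ki|ksi] := eqVneq k (s i); first by rewrite ki phi0 mulr0.
(* Rows [k] other than [s i] vanish, because [phi (delta_mx i j) = f i * phi (delta_mx i j)] and the
   diagonal matrix [f i] is zero at [k]. *)
rewrite -(mulE i i j) rmorphM mxE big1 ?mulr0 // => l _.
have [<-|kl] := eqVneq k l; last by rewrite -/(f i) f_diag ?mul0r.
have [->|/f_unique/eqP] := eqVneq (f i k k) 0; first by rewrite mul0r.
by rewrite (negbTE ksi).
Qed.

Lemma graded_iso_Phi (S S' : mx_family G K n) :
  strictly_elementary S -> strictly_elementary S' ->
  graded_iso S S' <-> pa_equiv (Phi S) (Phi S').
Proof.
rewrite strictly_elementaryE => /very_good_diagP[c fc ->].
by case/very_good_diagP => c' fc' ->; rewrite graded_isoP // pa_equivP.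
Qed.

End Equivalence.

(** * Equivalence of partial actions is an equivalence relation *)

Section PartialActionEquivalence.
Variable G : groupType.

Lemma pa_equiv_refl (T : Type) (alpha : paction_data G T) :
  pa_equiv alpha alpha.
Proof.
exists id; split=> [|g|g x _]; [by exists id | exact: image_id |].
exact: omap_id.
Qed.

Lemma pa_equiv_sym (T U : Type) (alpha : paction_data G T)
    (beta : paction_data G U) : pa_equiv alpha beta -> pa_equiv beta alpha.
Proof.
case=> sigma [[tau sigmaK tauK] sigma_set sigma_map].
exists tau; split=> [|g|g y]; first by exists sigma.
  rewrite -sigma_set; apply/seteqP; split=> [_ [_ [x gx <-] <-]|x gx].
    by rewrite sigmaK.
  by exists (sigma x) => //; exists x.
rewrite -sigma_set => -[x gx <-]; rewrite -sigma_map // sigmaK.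
by case: (pa_map alpha g x) => //= z; rewrite sigmaK.
Qed.

Lemma pa_equiv_trans (T U V : Type) (alpha : paction_data G T)
    (beta : paction_data G U) (gamma : paction_data G V) :
  pa_equiv alpha beta -> pa_equiv beta gamma -> pa_equiv alpha gamma.
Proof.
case=> sigma [sigma_bij sigma_set sigma_map] [tau [tau_bij tau_set tau_map]].
exists (tau \o sigma); split=> [|g|g x gx]; first exact: bij_comp.
  by rewrite -tau_set -sigma_set image_comp.
rewrite /= -tau_map; last by rewrite -sigma_set; exists x.
by rewrite -sigma_map //; case: (pa_map alpha g x).
Qed.

End PartialActionEquivalence.

(** * Classes, and maps induced between sets of classes *)

Section Classes.
Variables (T : Type) (A : set T) (R : T -> T -> Prop).
Hypotheses (Rrefl : forall x, R x x) (Rsym : forall x y, R x y -> R y x).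
Hypothesis Rtrans : forall x y z, R x y -> R y z -> R x z.

Lemma eqv_classP x y : A y -> eqv_class A R x = eqv_class A R y <-> R x y.
Proof.
move=> Ay; split=> [/seteqP[_ /(_ y)[]] //|xy].
apply/seteqP; split=> z [Az xz]; split=> //; first exact: Rtrans (Rsym xy) xz.
exact: Rtrans xy xz.
Qed.

End Classes.

Section InducedBijection.
Variables (T U : Type) (A : set T) (B : set U).
Variables (R : T -> T -> Prop) (Q : U -> U -> Prop) (f : T -> U).
Hypotheses (Qrefl : forall x, Q x x) (Qsym : forall x y, Q x y -> Q y x).
Hypothesis Qtrans : forall x y z, Q x y -> Q y z -> Q x z.
Hypothesis f_fun : forall x, A x -> B (f x).
Hypothesis f_surj : forall y, B y -> exists2 x, A x & f x = y.
Hypothesis RQ : forall x y, A x -> A y -> R x y <-> Q (f x) (f y).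

Lemma eqv_classes_bij : exists F : set T -> set U,
  (forall x, A x -> F (eqv_class A R x) = eqv_class B Q (f x)) /\
  set_bij (eqv_classes A R) (eqv_classes B Q) F.
Proof.
(* Saturating the image under [Q] defines [F] on every set, without choosing representatives. *)
pose F (C : set T) : set U :=
  [set y | B y /\ exists2 x, C x & Q (f x) y]%classic.
have F_class x : A x -> F (eqv_class A R x) = eqv_class B Q (f x).
  move=> Ax; apply/seteqP; split=> y [By].
    by case=> z [Az /(RQ Ax Az) xz] zy; split=> //; exact: Qtrans xz zy.
  by move=> xy; split=> //; exists x => //; split=> //; exact/RQ.
exists F; split=> //; split.
- by move=> _ [x Ax <-]; exists (f x); [exact: f_fun | rewrite F_class].
- move=> _ _ /set_mem[x Ax <-] /set_mem[y Ay <-]; rewrite !F_class //.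
  move/(eqv_classP Qrefl Qsym Qtrans _ (f_fun Ay)) => xy.
  (* Transitivity is applied to [Q] between images and carried back to [R] by [RQ]. *)
  apply/seteqP; split=> z [Az /RQ-/(_ _ Az) zP]; split=> //; apply/RQ => //.
    exact: Qtrans (Qsym xy) (zP Ax).
  exact: Qtrans xy (zP Ay).
- move=> _ [y /f_surj[x Ax <-] <-].
  by exists (eqv_class A R x); [exists x | exact: F_class].
Qed.

End InducedBijection.

Lemma free_pactions_setT (G : groupType) (T : Type) :
  @free_pactions G T (@classical_sets.setT (T * T)) = @free_trans_pactions G T.
Proof.
apply/seteqP; split=> alpha [pa fr orb]; split=> //.
  by move=> i j; have : [set: T * T]%classic (i, j) by []; rewrite -orb.
by apply/seteqP; split=> // -[i j] _; apply: orb.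
Qed.

Theorem corollary43 (K : fieldType) (n : nat) (G : groupType) :
  set_bij (@very_good_diag G K n)
    (@free_pactions G 'I_n.+1 (@classical_sets.setT ('I_n.+1 * 'I_n.+1)))
    (@Phi G K n) /\
  exists F : set (mx_family G K n) -> set (paction_data G 'I_n.+1),
    (forall S : mx_family G K n, strictly_elementary S ->
       F (eqv_class (@strictly_elementary G K n) (@graded_iso G K n) S) =
       eqv_class (@free_trans_pactions G 'I_n.+1) (@pa_equiv G 'I_n.+1 'I_n.+1)
         (Phi S)) /\
    set_bij
      (eqv_classes (@strictly_elementary G K n) (@graded_iso G K n))
      (eqv_classes (@free_trans_pactions G 'I_n.+1)
         (@pa_equiv G 'I_n.+1 'I_n.+1))
      F.
Proof.
rewrite free_pactions_setT.
have Phi_fun S : very_good_diag S -> free_trans_pactions (@Phi G K n S).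
  by case/very_good_diagP => c fc ->; exact: Phi_mx_grading_free_trans.
have Phi_surj alpha : free_trans_pactions alpha ->
    exists2 S, very_good_diag S & @Phi G K n S = alpha.
  case/(free_trans_pactionsP K) => c fc ->; exists (mx_grading K c) => //.
  exact: mx_grading_very_good_diag.
split.
  split=> [||alpha /Phi_surj[S vS <-]]; [exact: Phi_fun | | by exists S].
  move=> S S' /set_mem/very_good_diagP[c fc ->].
  by move=> /set_mem/very_good_diagP[c' fc' ->] /Phi_mx_grading_inj ->.
apply: eqv_classes_bij.
- exact: pa_equiv_refl.
- exact: pa_equiv_sym.
- by move=> alpha beta gamma; exact: pa_equiv_trans.
(* Strictly elementary gradings make up all of [very_good_diag], so [Phi_fun] and then [Phi_surj]
   apply. *)
- by rewrite strictly_elementaryE.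
- by rewrite strictly_elementaryE.
- exact: graded_iso_Phi.
Qed.
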